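(* Let $F=F(S)$ be the free group over a set $S$ with $|S|\geq 2$, let $G$ be a group equipped with a bi-invariant metric $d$, and let $\sigma\in\ell^\infty(G)$. Then the map $g_\sigma:F\to G$ is a quasi-morphism.
   Context: A metric $d$ on a group $G$ (with neutral element $e$) is bi-invariant if all left and right translations are isometries. For maps $f,g:X\to G$ on a set $X$, $d(f,g):=\sup_{x\in X}d(f(x),g(x))$; $f$ and $g$ are at bounded distance if $d(f,g)<\infty$, and $f$ is bounded if it is at bounded distance from the constant map $x\mapsto e$. A map $f:\Gamma\to G$ on a group $\Gamma$ is a quasi-morphism (or $\varepsilon$-representation) if the maps $\Gamma^2\to G$, $(x,x')\mapsto f(xx')$ and $(x,x')\mapsto f(x)f(x')$, are at bounded distance. $\ell^\infty(G)$ is the set of bounded sequences $\sigma=(\sigma(k))_{k\geq1}$ in $G$, i.e. $\|\sigma\|_\infty=\sup_k d(\sigma(k),e)<\infty$. Each such $\sigma$ is extended to an odd map $\sigma:\mathbb{Z}\to G$, i.e. $\sigma(-k)=\sigma(k)^{-1}$ and $\sigma(0)=e$. An element $x\in F(S)$ is called a power if $x=s^k$ for some $s\in S$ and $k\in\mathbb{Z}$. Each non-trivial $x\in F$ has a unique shortest factorization into powers, called the factorization of $x$: $x=x_0\cdots x_n$ with $x_i=s_i^{k_i}$, $s_i\in S$, $k_i\in\mathbb{Z}\setminus\{0\}$, and $s_i\neq s_{i+1}$ for $0\le i<n$. The map $g_\sigma:F\to G$ is defined on powers by $g_\sigma(s^k)=\sigma(k)$, and for $x$ with factorization $x=x_0\cdots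 x_n$ by the ordered product $g_\sigma(x)=\prod_{i=0}^n g_\sigma(x_i)=g_\sigma(x_0)\cdots g_\sigma(x_n)$. *)

(* Defs.v *)
From HB Require Import structures.
From mathcomp Require Import all_boot all_order all_algebra.
From mathcomp Require Import classical_sets reals ereal topology.

Set Implicit Arguments.
Unset Strict Implicit.
Unset Printing Implicit Defensive.

Import Order.TTheory GRing.Theory Num.Theory.

Local Open Scope group_scope.

Section Letters.
Variable S : choiceType.

(* [(s, false)] stands for [s] and [(s, true)] for its inverse. *)
Definition letter : Type := (S * bool)%type.

Definition inv_letter (a : letter) : letter := (a.1, ~~ a.2).

Definition reduced (w : seq letter) : bool :=
  sorted (fun a b => b != inv_letter a) w.

Record free_group := FreeGroup { word :> seq letter; word_reduced : reduced word }.

HB.instance Definition _ := [isSub for word].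
HB.instance Definition _ := [Choice of free_group by <:].

(* The reduced form of [a :: w], for [w] reduced. *)
Definition push (a : letter) (w : seq letter) : seq letter :=
  if w is b :: w' then if b == inv_letter a then w' else a :: w else [:: a].

Lemma inv_letterK : involutive inv_letter.
Proof. by case=> s b; rewrite /inv_letter /= negbK. Qed.

Lemma inv_letter_neq a : (inv_letter a == a) = false.
Proof. by case: a => s b; rewrite /inv_letter xpair_eqE /=; case: b; rewrite andbF. Qed.

Lemma reduced_behead a w : reduced (a :: w) -> reduced w.
Proof. exact: path_sorted. Qed.

Lemma push_reduced a w : reduced w -> reduced (push a w).
Proof.
case: w => [|b w] //= rw; case: ifPn => [_|ba]; first exact: reduced_behead rw.
by rewrite /reduced /= ba.
Qed.

Lemma push_cons a w : reduced (a :: w) -> push a w = a :: w.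
Proof. by case: w => [|b w] //= /andP[/negbTE->]. Qed.

Lemma pushK a w : reduced w -> push a (push (inv_letter a) w) = w.
Proof.
case: w => [|b w] rw /=; first by rewrite eqxx.
rewrite inv_letterK; case: eqP => [ba|_] /=; last by rewrite eqxx.
by rewrite push_cons -ba.
Qed.

Lemma foldr_push_reduced u w : reduced w -> reduced (foldr push w u).
Proof. by move=> rw; elim: u => //= a u; apply: push_reduced. Qed.

Lemma foldr_push_push a u w : reduced u -> reduced w ->
  foldr push w (push a u) = push a (foldr push w u).
Proof.
case: u => [|b u] //= ru rw; case: eqP => [->|_] //=.
by rewrite pushK// foldr_push_reduced.
Qed.

Lemma foldr_push_nil w : reduced w -> foldr push [::] w = w.
Proof.
by elim: w => //= a w IHw raw; rewrite IHw ?(reduced_behead raw)// push_cons.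
Qed.

Definition inv_word (w : seq letter) : seq letter := rev (map inv_letter w).

Lemma inv_wordK : involutive inv_word.
Proof. by move=> w; rewrite /inv_word map_rev revK mapK//; exact: inv_letterK. Qed.

Lemma inv_word_reduced w : reduced w -> reduced (inv_word w).
Proof.
rewrite /reduced /inv_word rev_sorted sorted_map; apply: sub_sorted => a b /=.
by apply: contra => /eqP/(can_inj inv_letterK)->; rewrite inv_letterK.
Qed.

Lemma mulV_word w u : reduced u -> foldr push (foldr push u w) (inv_word w) = u.
Proof.
move=> ru; elim: w => //= a w IHw; rewrite /inv_word /= rev_cons foldr_rcons.
have := @pushK (inv_letter a) _ (foldr_push_reduced w ru).
by rewrite inv_letterK => ->.
Qed.

Definition free_mul (x y : free_group) : free_group :=
  FreeGroup (foldr_push_reduced x (word_reduced y)).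
Definition free_one : free_group := @FreeGroup [::] isT.
Definition free_inv (x : free_group) : free_group :=
  FreeGroup (inv_word_reduced (word_reduced x)).

Lemma free_mulA : associative free_mul.
Proof.
case=> u ru [v rv] [w rw]; apply/val_inj => /=.
elim: u ru => //= a u IHu rau; rewrite IHu ?(reduced_behead rau)//.
by rewrite foldr_push_push// foldr_push_reduced.
Qed.

Lemma free_mul1 : left_id free_one free_mul.
Proof. by move=> x; apply/val_inj. Qed.

Lemma free_mulr1 : right_id free_one free_mul.
Proof. by case=> w rw; apply/val_inj; apply: foldr_push_nil. Qed.

Lemma free_mulV : left_inverse free_one free_inv free_mul.
Proof.
case=> w rw; apply/val_inj => /=.
by rewrite -[X in foldr push X]foldr_push_nil// mulV_word.
Qed.

Lemma free_mulrV : right_inverse free_one free_inv free_mul.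
Proof.
move=> x; rewrite -[RHS](free_mulV (free_inv x)); congr free_mul.
by apply/val_inj; rewrite /= inv_wordK.
Qed.

HB.instance Definition _ := isGroup.Build free_group
  free_mulA free_mul1 free_mulr1 free_mulV free_mulrV.

Definition free_gen (s : S) : free_group := @FreeGroup [:: (s, false)] isT.

End Letters.

Definition expgz (G : groupType) (x : G) (k : int) : G :=
  match k with Posz n => x ^+ n | Negz n => x ^- n.+1 end.

Lemma expgzD (G : groupType) (y : G) j k : expgz y (j + k)%R = expgz y j * expgz y k.
Proof.
have natB m n : expgz y (m%:Z - n%:Z)%R = y ^+ m / y ^+ n.
  have [mn|/ltnW mn] := leqP n m; first by rewrite subzn//= expgnFr.
  rewrite -opprB subzn//; have -> : y ^+ m / y ^+ n = y ^- (n - m).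
    by rewrite expgnFr// invgF.
  by case: (n - m)%N => [|d] //=; rewrite invg1.
have int_sub i : exists m n, i = (m%:Z - n%:Z)%R.
  case: i => n; first by exists n, 0%N; rewrite subr0.
  by exists 0%N, n.+1; rewrite NegzE sub0r.
have [m [n ->]] := int_sub j; have [p [q ->]] := int_sub k.
have comm a b : y ^+ a / y ^+ b = (y ^+ b)^-1 * y ^+ a.
  exact/commuteV/commuteX2.
rewrite addrACA -opprD -!PoszD !natB (addnC n) !expgnDr invgM -!mulgA.
by congr (_ * _); rewrite !mulgA comm.
Qed.

Section UniversalProperty.
Variables (S : choiceType) (H : groupType) (f : S -> H).

Definition eval_letter (a : letter S) : H := if a.2 then (f a.1)^-1 else f a.1.

Definition free_lift (x : free_group S) : H :=
  \prod_(a <- word x) eval_letter a.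

Lemma eval_inv_letter a : eval_letter (inv_letter a) = (eval_letter a)^-1.
Proof. by case: a => s [] //=; rewrite /eval_letter /= invgK. Qed.

Lemma eval_push a w :
  \prod_(b <- push a w) eval_letter b = eval_letter a * \prod_(b <- w) eval_letter b.
Proof.
case: w => [|b w] /=; first by rewrite big_cons.
case: eqP => [->|_]; last by rewrite big_cons.
by rewrite big_cons eval_inv_letter mulVKg.
Qed.

Lemma free_liftM : {morph free_lift : x y / x * y}.
Proof.
case=> u ru [v rv]; rewrite /free_lift /=.
elim: u {ru} => [|a u IHu] /=; first by rewrite big_nil mul1g.
by rewrite eval_push IHu big_cons mulgA.
Qed.

Lemma free_lift_gen s : free_lift (free_gen s) = f s.
Proof. by rewrite /free_lift big_seq1. Qed.

Lemma free_lift_unique (h : free_group S -> H) :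
  {morph h : x y / x * y} -> (forall s, h (free_gen s) = f s) -> h =1 free_lift.
Proof.
move=> hM hg; have h1 : h 1 = 1 by apply: (@mulgI _ (h 1)); rewrite -hM !mulg1.
have hV x : h x^-1 = (h x)^-1.
  by apply/esym/mulg1_eq; rewrite -hM mulgV h1.
case=> w rw; elim: w rw => [|a w IHw] raw.
  rewrite /free_lift big_nil -h1; congr h; exact/val_inj.
have rw := reduced_behead raw.
have E : FreeGroup raw =
    (if a.2 then (free_gen a.1)^-1 else free_gen a.1) * FreeGroup rw.
  by apply/val_inj; case: a raw => s [] raw /=; rewrite push_cons.
rewrite [in LHS]E hM IHw /free_lift /= big_cons; congr (_ * _).
by rewrite /eval_letter; case: ifP => _; rewrite ?hV hg.
Qed.

End UniversalProperty.

Section Factorization.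
Variable S : choiceType.
Implicit Types (x : free_group S) (l : seq (S * int)) (w : seq (letter S)).

Definition power (s : S) (k : int) : free_group S := expgz (free_gen s) k.

Definition powers_prod l : free_group S := \prod_(p <- l) power p.1 p.2.

Definition normal_powers l : bool :=
  sorted (fun p q => p.1 != q.1) l && all (fun p => p.2 != 0%R) l.

Definition add_power (s : S) (k : int) l : seq (S * int) :=
  if k == 0%R then l else
  if l is (t, m) :: l' then
    if s == t then if (k + m == 0)%R then l' else (s, (k + m)%R) :: l'
    else (s, k) :: l
  else [:: (s, k)].

(* On a reduced word this is run-length encoding. *)
Fixpoint syllables w : seq (S * int) :=
  if w is (s, b) :: w' then add_power s (if b then -1 else 1)%R (syllables w')
  else [::].

Definition factorization x : seq (S * int) := syllables (word x).

Lemma normal_behead p l : normal_powers (p :: l) -> normal_powers l.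
Proof. by case/andP => /path_sorted sl /= /andP[_ al]; apply/andP. Qed.

Lemma normal_cons s k t m l : normal_powers ((s, k) :: (t, m) :: l) =
  [&& s != t, k != 0%R & normal_powers ((t, m) :: l)].
Proof.
rewrite /normal_powers /=; case: (s != t) => //=.
by case: (path _ _ _); rewrite /= ?andbF.
Qed.

Lemma normal_seq1 s k : normal_powers [:: (s, k)] = (k != 0%R).
Proof. by rewrite /normal_powers /= andbT. Qed.

Lemma normal_head s k k' l :
  normal_powers ((s, k) :: l) -> k' != 0%R -> normal_powers ((s, k') :: l).
Proof.
case: l => [|[t m] l]; first by rewrite !normal_seq1.
by rewrite !normal_cons => /and3P[-> _ ->] ->.
Qed.

Lemma add_power_normal s k l : normal_powers l -> normal_powers (add_power s k l).
Proof.
rewrite /add_power; case: eqVneq => // k0.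
case: l => [|[t m] l] nl; first by rewrite normal_seq1.
case: eqVneq => [st|st]; last by rewrite normal_cons st k0.
case: eqVneq => [_|km]; first exact: normal_behead nl.
by rewrite st; apply: normal_head nl km.
Qed.

Lemma add_power_cons s k l : normal_powers ((s, k) :: l) -> add_power s k l = (s, k) :: l.
Proof.
case: l => [|[t m] l]; rewrite /add_power.
  by rewrite normal_seq1 => /negbTE->.
by rewrite normal_cons => /and3P[/negbTE-> /negbTE-> _].
Qed.

Lemma add_powerD s j k l : normal_powers l ->
  add_power s j (add_power s k l) = add_power s (j + k)%R l.
Proof.
move=> nl; rewrite {2}/add_power; have [->|k0] := eqVneq k 0%R; first by rewrite addr0.
have [->|j0] := eqVneq j 0%R.
  by rewrite add0r /add_power eqxx (negbTE k0).
case: l nl => [|[t m] l] nl.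
  by rewrite /add_power (negbTE j0) eqxx.
have [st|st] := eqVneq s t; last first.
  by rewrite /add_power (negbTE j0) eqxx (negbTE st).
rewrite -{}st in nl *; rewrite [RHS]/add_power eqxx -addrA.
have m0 : m != 0%R by case/andP: nl => _ /andP[].
have [km|km] := eqVneq (k + m)%R 0%R.
  rewrite km addr0 (negbTE j0).
  have -> : m = (- k)%R by apply/eqP; rewrite -addr_eq0 addrC km.
  rewrite add_power_cons; last exact: normal_head nl _.
  by rewrite addr_eq0; case: eqVneq => // ->.
rewrite /add_power (negbTE j0) eqxx.
have [jk|//] := eqVneq (j + k)%R 0%R.
by rewrite addrA jk add0r (negbTE m0).
Qed.

Lemma syllables_normal w : normal_powers (syllables w).
Proof. by elim: w => //= -[s b] w IHw; apply: add_power_normal. Qed.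

Lemma syllables_push s b w : syllables (push (s, b) w) =
  add_power s (if b then -1 else 1)%R (syllables w).
Proof.
case: w => [|c w] //=; case: eqP => [->|_] //=.
by rewrite add_powerD ?syllables_normal//; case: b; rewrite /add_power.
Qed.

Lemma factorizationM s k x :
  factorization (power s k * x) = add_power s k (factorization x).
Proof.
have nl (y : free_group S) : normal_powers (factorization y) by exact: syllables_normal.
have pos n y : factorization (free_gen s ^+ n * y) = add_power s n%:Z (factorization y).
  elim: n y => [|n IHn] y; first by rewrite expg0 mul1g.
  by rewrite expgS -mulgA [LHS]syllables_push -/(factorization _) IHn add_powerD.
case: k => n; first exact: pos.
have E : x = free_gen s ^+ n.+1 * (power s (Negz n) * x) by rewrite mulVKg.
by rewrite [in RHS]E NegzE pos add_powerD// addNr /add_power eqxx.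
Qed.

Lemma powers_prod_cons s k l : powers_prod ((s, k) :: l) = power s k * powers_prod l.
Proof. by rewrite /powers_prod big_cons. Qed.

Lemma factorization1 : factorization 1 = [::].
Proof. by []. Qed.

Lemma factorization_normal x : normal_powers (factorization x).
Proof. exact: syllables_normal. Qed.

Lemma powers_prodK l : normal_powers l -> factorization (powers_prod l) = l.
Proof.
elim: l => [|[s k] l IHl] nl; first by rewrite /powers_prod big_nil.
by rewrite powers_prod_cons factorizationM IHl ?(normal_behead nl)// add_power_cons.
Qed.

Lemma free_ind (P : free_group S -> Prop) : P 1 ->
  (forall s k x, P x -> P (power s k * x)) -> forall x, P x.
Proof.
move=> P1 PM; case=> w rw; elim: w rw => [|[s b] w IHw] raw.
  by have -> : FreeGroup raw = 1 by exact/val_inj.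
have rw := reduced_behead raw.
have -> : FreeGroup raw = power s (if b then -1 else 1)%R * FreeGroup rw.
  by apply/val_inj; case: b raw => raw /=; rewrite push_cons.
exact: PM.
Qed.

Lemma powers_prod_add_power s k l :
  powers_prod (add_power s k l) = power s k * powers_prod l.
Proof.
rewrite /add_power; case: eqVneq => [->|_]; first by rewrite mul1g.
case: l => [|[t m] l]; first by rewrite powers_prod_cons.
rewrite powers_prod_cons; case: eqVneq => [<-|_]; last by rewrite !powers_prod_cons.
rewrite mulgA -expgzD; case: eqVneq => [->|_]; first by rewrite mul1g.
by rewrite powers_prod_cons.
Qed.

Lemma factorizationK x : powers_prod (factorization x) = x.
Proof.
elim/free_ind: x => [|s k x IHx]; first by rewrite /powers_prod big_nil.
by rewrite factorizationM powers_prod_add_power IHx.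
Qed.

Lemma size_add_power s k l : size (add_power s k l) <= (size l).+1.
Proof.
rewrite /add_power; case: eqP => // _; case: l => [|[t m] l] //.
by case: eqP => // _; case: eqP => //= _; rewrite ltnW.
Qed.

(* The factorization is the unique shortest way of writing [x] as a product of
   powers. *)
Lemma size_factorization l : size (factorization (powers_prod l)) <= size l.
Proof.
elim: l => [|[s k] l IHl]; first by rewrite /powers_prod big_nil.
rewrite powers_prod_cons factorizationM.
exact: leq_trans (size_add_power _ _ _) _.
Qed.

Lemma shortest_factorization l :
  size l <= size (factorization (powers_prod l)) -> l = factorization (powers_prod l).
Proof.
elim: l => [|[s k] l IHl]; first by rewrite /powers_prod big_nil.
rewrite powers_prod_cons factorizationM /= => sl.
have {}IHl : l = factorization (powers_prod l).
  by apply: IHl; rewrite -ltnS (leq_trans sl)// size_add_power.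
move: sl; rewrite -{}IHl /add_power.
case: eqP => _; first by rewrite ltnn.
case: l => [|[t m] l] //=; case: eqP => // _.
by case: eqP => /= _; rewrite ?ltnn// ltnNge ltnW.
Qed.

End Factorization.

HB.mixin Record Metric_isBiInvariant (R : realType) G
    of Metric R G & Group G := {
  mdist_mull : forall g x y : G, mdist (g * x) (g * y) = mdist x y :> R;
  mdist_mulr : forall g x y : G, mdist (x * g) (y * g) = mdist x y :> R
}.

#[short(type="biinvMetricGroupType")]
HB.structure Definition BiInvMetricGroup (R : realType) :=
  {G of Metric_isBiInvariant R G & Metric R G & Group G}.

Section QuasiMorphism.
Variables (R : realType) (G : biinvMetricGroupType R).

Definition map_dist (X : Type) (f g : X -> G) : \bar R :=
  ereal_sup [set (mdist (f x) (g x))%:E | x in setT].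

Definition bounded_distance (X : Type) (f g : X -> G) : Prop :=
  (map_dist f g < +oo)%E.

Definition quasi_morphism (Gamma : groupType) (f : Gamma -> G) : Prop :=
  bounded_distance (fun p : Gamma * Gamma => f (p.1 * p.2))
                   (fun p : Gamma * Gamma => f p.1 * f p.2).

(* Sequences are indexed by the integers [k >= 1]; the value of
   [sigma : nat -> G] at 0 is never used. *)
Definition linfty_norm (sigma : nat -> G) : \bar R :=
  ereal_sup [set (mdist (sigma k) 1%g)%:E | k in [set k | (1 <= k)%N]].

Definition linfty : set (nat -> G) := [set sigma | (linfty_norm sigma < +oo)%E].

End QuasiMorphism.

Definition odd_extension (G : groupType) (sigma : nat -> G) (k : int) : G :=
  match k with
  | Posz 0 => 1
  | Posz n => sigma n
  | Negz n => (sigma n.+1)^-1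
  end.

Lemma odd_extensionN (G : groupType) (sigma : nat -> G) k :
  odd_extension sigma (- k)%R = (odd_extension sigma k)^-1.
Proof. by case: k => [[|n]|n] /=; rewrite ?invg1 ?invgK. Qed.

Definition g_ (G : groupType) (sigma : nat -> G) (S : choiceType)
    (x : free_group S) : G :=
  \prod_(p <- factorization x) odd_extension sigma p.2.

Lemma g_power (G : groupType) (sigma : nat -> G) (S : choiceType) (s : S) k :
  g_ sigma (power s k) = odd_extension sigma k.
Proof.
have [->|k0] := eqVneq k 0%R; first by rewrite /g_ big_nil.
have -> : power s k = powers_prod [:: (s, k)] by rewrite /powers_prod big_seq1.
by rewrite /g_ powers_prodK ?normal_seq1// big_seq1.
Qed.

(* Main.v *)
Require Import Defs.
From mathcomp Require Import all_boot all_order all_algebra.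
From mathcomp Require Import classical_sets reals ereal topology.

(** Write [x] and [y] by their factorizations and look at the junction in the
    product [x * y].  If the last power of [x] and the first power of [y] are
    opposite powers of one generator, they cancel; since [odd_extension sigma]
    is odd, their values cancel in [g_ sigma x * g_ sigma y] too, exactly, so
    both can be deleted without changing either side of the comparison.  After
    all such cancellations, either the two factorizations concatenate to a
    factorization and the two sides are equal, or one pair [s^i], [s^j] merges
    into [s^(i + j)] with [i + j != 0], and the reduction stops there.  By
    bi-invariance the common factors around the merged syllable do not change
    the distance, so the defect of [g_ sigma] is at most the defect of
    [odd_extension sigma] as a map from the integers ([mdist_g_mul]).  That map
    is bounded, hence has bounded defect ([mdist_odd_extensionD]). *)

Set Implicit Arguments.
Unset Strict Implicit.
Unset Printing Implicit Defensive.

Import Order.TTheory GRing.Theory Num.Theory.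

Local Open Scope group_scope.

(** * Products of factorizations in the free group *)

Section Junction.
Variable S : choiceType.
Implicit Types (l : seq (S * int)) (p q : S * int).

(** The two conditions bear on the generators and on the exponents
    separately, so an exponent can be replaced without touching adjacency. *)
Lemma normal_powersE l :
  normal_powers l = sorted (fun s t => s != t) (unzip1 l) &&
                    all (fun k => k != 0%R) (unzip2 l).
Proof. by rewrite /normal_powers sorted_map all_map. Qed.

Lemma normal_powers_cat_cons l1 p l2 :
  normal_powers (l1 ++ p :: l2) =
    normal_powers (rcons l1 p) && normal_powers (p :: l2).
Proof.
rewrite /normal_powers sorted_cat_cons all_cat all_rcons /=.
by case: (_ != _); case: (sorted _ _); case: (all _ l1); rewrite /= ?andbF.
Qed.

Lemma normal_powers_rcons_exp l s k k' : k' != 0%R ->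
  normal_powers (rcons l (s, k)) -> normal_powers (rcons l (s, k')).
Proof.
by move=> k'0; rewrite !normal_powersE /unzip1 /unzip2 !map_rcons !all_rcons /=
  k'0 => /and3P[-> _ ->].
Qed.

Lemma normal_powers_belast l p : normal_powers (rcons l p) -> normal_powers l.
Proof.
rewrite /normal_powers all_rcons -cats1 => /and3P[sl _ ->].
by rewrite (cat_sorted2 sl).
Qed.

Lemma powers_prod_nil : powers_prod [::] = 1 :> free_group S.
Proof. by rewrite /powers_prod big_nil. Qed.

Lemma powers_prod_cat l1 l2 :
  powers_prod (l1 ++ l2) = powers_prod l1 * powers_prod l2.
Proof. by rewrite /powers_prod big_cat. Qed.

Lemma powers_prod_rcons_cons l1 s j k l2 :
  powers_prod (rcons l1 (s, j)) * powers_prod ((s, k) :: l2) =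
    powers_prod (l1 ++ (s, (j + k)%R) :: l2).
Proof.
rewrite -cats1 !powers_prod_cat !powers_prod_cons /power expgzD.
by rewrite powers_prod_nil mulg1 !mulgA.
Qed.

End Junction.

(** * The defect of the extended map *)

Section Defect.
Variables (R : realType) (S : choiceType) (G : biinvMetricGroupType R).
Variable sigma : nat -> G.
Implicit Types (l : seq (S * int)).

Lemma g_1 : g_ sigma (1 : free_group S) = 1.
Proof. by rewrite /g_ factorization1 big_nil. Qed.

Lemma g_powers_prod l : normal_powers l ->
  g_ sigma (powers_prod l) = \prod_(p <- l) odd_extension sigma p.2.
Proof. by move=> nl; rewrite /g_ powers_prodK. Qed.

(** The induction peels the last power off [l1]: it continues only through
    exact cancellations, hence the bound [D] is incurred at most once. *)
Lemma mdist_g_powers_prod (D : R) l1 l2 :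
  (forall j k, mdist (odd_extension sigma (j + k)%R)
     (odd_extension sigma j * odd_extension sigma k)%g <= D)%R ->
  normal_powers l1 -> normal_powers l2 ->
  (mdist (g_ sigma (powers_prod l1 * powers_prod l2)%g)
     (g_ sigma (powers_prod l1) * g_ sigma (powers_prod l2))%g <= D)%R.
Proof.
move=> defect; have D0 : (0 <= D)%R.
  exact: le_trans (mdist_ge0 _ _) (defect 0%R 0%R).
elim/last_ind: l1 l2 => [|l1 [s j] IHl1] l2 nl1 nl2.
  by rewrite powers_prod_nil mul1g g_1 mul1g mdistxx.
case: l2 nl2 => [|[t k] l2] nl2.
  by rewrite powers_prod_nil mulg1 g_1 mulg1 mdistxx.
have [st|st] := eqVneq s t; last first.
  (* Distinct generators: the concatenation is already a factorization. *)
  have ncat : normal_powers (rcons l1 (s, j) ++ (t, k) :: l2).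
    rewrite cat_rcons normal_powers_cat_cons nl1 normal_cons st nl2 /= andbT.
    by move: nl1; rewrite /normal_powers all_rcons => /andP[_ /andP[]].
  by rewrite -powers_prod_cat !g_powers_prod// big_cat mdistxx.
rewrite -{}st in nl2 *; rewrite powers_prod_rcons_cons.
rewrite [g_ _ (powers_prod (rcons _ _))]g_powers_prod//.
rewrite [g_ _ (powers_prod (_ :: _))]g_powers_prod//.
rewrite big_rcons big_cons /=.
have nl1' := normal_powers_belast nl1; have nl2' := normal_behead nl2.
have [jk|jk] := eqVneq (j + k)%R 0%R.
  have -> : k = (- j)%R by apply/eqP; rewrite -addr_eq0 addrC jk.
  rewrite addrN powers_prod_cat powers_prod_cons mul1g odd_extensionN mulgA mulgK.
  by have := IHl1 _ nl1' nl2'; rewrite !(@g_powers_prod l1, @g_powers_prod l2).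
rewrite g_powers_prod; last first.
  rewrite normal_powers_cat_cons (normal_powers_rcons_exp jk nl1).
  exact: normal_head nl2 jk.
by rewrite big_cat big_cons /= -!mulgA mdist_mull !mulgA mdist_mulr.
Qed.

Lemma mdist_g_mul (D : R) (x y : free_group S) :
  (forall j k, mdist (odd_extension sigma (j + k)%R)
     (odd_extension sigma j * odd_extension sigma k)%g <= D)%R ->
  (mdist (g_ sigma (x * y)%g) (g_ sigma x * g_ sigma y)%g <= D)%R.
Proof.
move=> defect; rewrite -[x]factorizationK -[y]factorizationK.
by apply: mdist_g_powers_prod => //; exact: factorization_normal.
Qed.

End Defect.

(** * The defect of a bounded odd map on the integers *)

Section BoundedDefect.
Variables (R : realType) (G : biinvMetricGroupType R).

Lemma mdist_mul1 (x y : G) : (mdist (x * y)%g 1%g <= mdist x 1%g + mdist y 1%g)%R.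
Proof.
rewrite [leRHS]addrC -(mdist_mull x y 1) mulg1.
exact: metric_triangle.
Qed.

Lemma mdist_inv1 (x : G) : mdist x^-1 1 = mdist x 1.
Proof. by rewrite -(mdist_mull x) mulgV mulg1 metric_sym. Qed.

Lemma mdist_odd_extension1 (sigma : nat -> G) : linfty sigma ->
  exists C : R, forall k, (mdist (odd_extension sigma k) 1%g <= C)%R.
Proof.
move=> bsigma.
have ub n : ((mdist (sigma n.+1) 1%g)%:E <= linfty_norm sigma)%E.
  by apply: ereal_sup_ubound; exists n.+1.
have [C CE] : exists C : R, linfty_norm sigma = C%:E.
  move: bsigma (ub 0%N); rewrite /linfty /=.
  by case: (linfty_norm sigma) => // C; exists C.
exists C; have {}ub n : (mdist (sigma n.+1) 1%g <= C)%R.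
  by rewrite -lee_fin -CE.
case=> [[|n]|n] /=; rewrite ?mdist_inv1//.
by rewrite mdistxx (le_trans _ (ub 0%N)) ?mdist_ge0.
Qed.

Lemma mdist_odd_extensionD (sigma : nat -> G) : linfty sigma ->
  exists D : R, forall j k, (mdist (odd_extension sigma (j + k)%R)
    (odd_extension sigma j * odd_extension sigma k)%g <= D)%R.
Proof.
move=> /mdist_odd_extension1[C bC]; exists (C + (C + C))%R => j k.
apply: le_trans (metric_triangle _ 1%g _) _; rewrite lerD//.
rewrite metric_sym; apply: le_trans (mdist_mul1 _ _) _.
by rewrite lerD.
Qed.

End BoundedDefect.

Theorem proposition5p1 (R : realType) (S : choiceType)
  (hS : exists s t : S, s != t) (G : biinvMetricGroupType R)
  (sigma : nat -> G) (hsigma : linfty sigma) :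
  quasi_morphism (fun x : free_group S => g_ sigma x).
Proof.
have [D defect] := mdist_odd_extensionD hsigma.
rewrite /quasi_morphism /bounded_distance; apply: le_lt_trans (ltry D).
apply: ge_ereal_sup => _ [[x y] _ <-]; rewrite lee_fin.
exact: mdist_g_mul.
Qed.
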